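(* Let $\mathcal{Z}=\mathcal{N}\cup\mathcal{J}$ be the node set of a finite arborescence with more than one node, with root $0$, set of nests (non-leaf nodes) $\mathcal{N}$ and set of alternatives (leaves) $\mathcal{J}$. Let $\lambda_n\in(0,1]$ for $n\in\mathcal{N}$, with $\lambda_0=1$, and let $\Lambda_n=\prod_{t=1}^{d_n}\lambda_{n(t)}$. Let $(\varepsilon_j)_{j\in\mathcal{J}}$ be a random vector distributed according to the (multi-layer) nested logit distribution, i.e. for all $(A_j)_{j\in\mathcal{J}}\in\mathbb{R}^{\mathcal{J}}$, $$\Pr(\varepsilon_j\le A_j\ \forall j\in\mathcal{J})=\exp(-\exp(-a_0)),$$ where $a\in\mathbb{R}^{\mathcal{Z}}$ is defined recursively, in ascending order of height, by $a_z=A_z$ for $z\in\mathcal{J}$ and $$a_n=-\Lambda_n\log\left(\sum_{z\in\mathcal{N}_n\cup\mathcal{J}_n}\exp(-a_z/\Lambda_n)\right)\quad\text{for } n\in\mathcal{N}.$$ Then the random vector $(\varepsilon_j)_{j\in\mathcal{J}}$ can be represented (i.e. has the same joint distribution as the vector given) by $$\varepsilon_j=\sum_{t=1}^{d_{n_j}}\Lambda_{n_j(t)}\log Z_{n_j(t)}+\Lambda_{n_j}\epsilon_j,\qquad j\in\mathcal{J},$$ where the variables $\epsilon_j\sim\mathcal{G}(0,1)$ for $j\in\mathcal{J}$ and $Z_n\sim\mathcal{P}(\lambda_n)$ for $n\in\mathcal{N}\setminus\{0\}$ are all independent.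
   Context: Trees. An arborescence on a finite set of nodes $\mathcal{Z}$ with root $0\in\mathcal{Z}$ is a directed graph on $\mathcal{Z}$ such that there is exactly one directed path from $0$ to any node (a directed rooted tree). Nodes with no outward arcs are leaves, called alternatives; their set is $\mathcal{J}$. The other nodes are called nests; their set is $\mathcal{N}$, so $\mathcal{Z}=\mathcal{N}\cup\mathcal{J}$ and $0\in\mathcal{N}$. For a nest $n$, $\mathcal{N}_n$ is the set of its children that are nests and $\mathcal{J}_n$ the set of its children that are alternatives ($\mathcal{N}_n\cup\mathcal{J}_n\neq\emptyset$). The parent of a node $z\ne 0$ is a nest denoted $n_z$. The depth $d_z$ of a node $z$ is the number of edges on the path from $0$ to $z$ (so $d_0=0$). The height $h_z$ of $z$ is the number of edges on the longest path from $z$ to a leaf (so alternatives have height $0$). For a nest $n$ of depth $d$, the path from the root to $n$, with the root omitted, is denoted $n(1),\dots,n(d)$, where $n(1)\in\mathcal{N}_0$, $n(k+1)\in\mathcal{N}_{n(k)}$ and $n(d)=n$. An empty product equals $1$ (so $\Lambda_0=1$) and an empty sum equals $0$. Distributions. ''$\sim$'' means ''is distributed as''. $\mathcal{G}(0,1)$ is the standard Gumbel distribution, with cumulative distribution function $z\mapsto\exp(-\exp(-z))$. For $0<\lambda\le 1$, $\mathcal{P}(\lambda)$ is the positive stable distribution with parameter $\lambda$: the probability distribution on $\mathbb{R}_+$ whose Laplace transform is $\mathbb{E}_{Z\sim\mathcal{P}(\lambda)}[\exp(-tZ)]=\exp(-t^{\lambda})$ for all $t\ge 0$ (its existence is a known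 fact). A variable with law $\mathcal{P}(\lambda)$ is almost surely strictly positive, so its logarithm is almost surely well defined. *)

(* Defs.v *)
(* MathComp / MathComp-Analysis *)
From mathcomp Require Import all_boot all_order all_algebra.
From mathcomp Require Import all_classical all_reals all_analysis.

Set Implicit Arguments.
Unset Strict Implicit.
Unset Printing Implicit Defensive.

Import Order.TTheory GRing.Theory Num.Theory.
Import numFieldNormedType.Exports.

Local Open Scope classical_set_scope.
Local Open Scope ring_scope.

(* [p] lists the nodes of a directed walk from [x] to [z], with [x] omitted. *)
Definition is_walk (T : eqType) (e : rel T) (x : T) (p : seq T) (z : T) :
    bool :=
  path e x p && (last x p == z).

(* Quantifying over walks rather than simple paths is what excludes loops and
   arcs pointing back towards the root. *)
Record arborescence (T : finType) := Arborescence {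
  tree_root : T;
  tree_arc : rel T;
  arborescenceP : forall z : T,
    exists! p : seq T, is_walk tree_arc tree_root p z
}.

Section Tree.
Context (T : finType) (tr : arborescence T).

Definition nest (z : T) : bool := [exists y, tree_arc tr z y].

Definition alt : finType := {z : T | ~~ nest z}.

Lemma ex_walk (z : T) : exists p, is_walk (tree_arc tr) (tree_root tr) p z.
Proof. by have [p [pz _]] := arborescenceP tr z; exists p. Qed.

(* The sequence z(1), ..., z(d) of the nodes on the path from the root to z;
   it is empty when z is the root. *)
Definition tpath (z : T) : seq T := xchoose (ex_walk z).

(* The default value only matters for the root, which has no parent. *)
Definition parent (z : T) : T :=
  odflt (tree_root tr) [pick y | tree_arc tr y z].

Definition Lambda (R : realType) (lam : T -> R) (n : T) : R :=
  \prod_(m <- tpath n) lam m.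

Definition nl_values (R : realType) (lam : T -> R) (A : alt -> R) (a : T -> R)
    : Prop :=
  (forall j : alt, a (sval j) = A j) /\
  (forall n : T, nest n ->
     a n = - Lambda lam n *
           ln (\sum_(z | tree_arc tr n z) expR (- a z / Lambda lam n))).

Lemma tpath_walk (z : T) : is_walk (tree_arc tr) (tree_root tr) (tpath z) z.
Proof. exact: (xchooseP (ex_walk z)). Qed.

Lemma tpath_unique (z : T) (p : seq T) :
  is_walk (tree_arc tr) (tree_root tr) p z -> tpath z = p.
Proof.
have [q [_ uq]] := arborescenceP tr z => pz.
by rewrite -(uq _ pz) -(uq _ (tpath_walk z)).
Qed.

Lemma tpath_arc (y z : T) : tree_arc tr y z -> tpath z = rcons (tpath y) z.
Proof.
move=> yz; apply: tpath_unique; have /andP[py /eqP ly] := tpath_walk y.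
by rewrite /is_walk rcons_path py ly yz last_rcons eqxx.
Qed.

Lemma parent_arc (y z : T) : tree_arc tr y z -> parent z = y.
Proof.
move=> yz; rewrite /parent; case: pickP => [x xz | /(_ y)]; last by rewrite yz.
have /andP[_ /eqP lx] := tpath_walk x; have /andP[_ /eqP ly] := tpath_walk y.
have /rcons_inj[exy] : rcons (tpath x) z = rcons (tpath y) z.
  by rewrite -!tpath_arc.
by rewrite /= -lx exy ly.
Qed.

Lemma size_tpath (z : T) : (size (tpath z) < #|T|)%N.
Proof.
have /andP[pz /eqP lz] := tpath_walk z.
case/shortenP: pz lz (erefl (tpath z)) => p pp up _ lz _.
have -> : tpath z = p by apply: tpath_unique; rewrite /is_walk pp lz eqxx.
by rewrite -ltnS -[(size p).+1]/(size (tree_root tr :: p)) -(card_uniqP up)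
   ltnS max_card.
Qed.

Lemma nl_values_exists_unique (R : realType) (lam : T -> R) (A : alt -> R) :
  exists! a : T -> R, nl_values lam A a.
Proof.
pose step (n : T) (a : T -> R) :=
  - Lambda lam n * ln (\sum_(z | tree_arc tr n z) expR (- a z / Lambda lam n)).
have eq_step n a b :
    (forall z, tree_arc tr n z -> a z = b z) -> step n a = step n b.
  move=> ab; rewrite /step; congr (_ * ln _).
  by apply: eq_bigr => z nz; rewrite ab.
pose fix f (k : nat) (z : T) {struct k} : R :=
  if insub z is Some j then A j else
  if k is k'.+1 then step z (f k') else 0.
pose m z := (#|T| - size (tpath z))%N.
have m_arc y z : tree_arc tr y z -> m y = (m z).+1.
  move=> yz; have := size_tpath z; rewrite /m (tpath_arc yz) size_rcons => h.
  by rewrite -subSn ?subSS // ltnW.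
have f_alt k (j : alt) : f k (sval j) = A j by case: k => [|k] /=; rewrite valK.
have f_nest k n : nest n -> f k.+1 n = step n (f k).
  by move=> nn; rewrite /= insubN // negbK.
have stable k : forall l z, (m z <= k)%N -> (m z <= l)%N -> f k z = f l z.
  elim: k => [|k IH] l z.
    by rewrite /m leqNgt subn_gt0 size_tpath.
  case: l => [|l] mk ml.
    by move: ml; rewrite /m leqNgt subn_gt0 size_tpath.
  have [nz|nz] := boolP (nest z); last first.
    by rewrite -[z]/(sval (exist (fun z => ~~ nest z) z nz : alt)) !f_alt.
  rewrite !f_nest //; apply: eq_step => y zy.
  by apply: IH; rewrite -ltnS -(m_arc _ _ zy).
have Tgt0 : (0 < #|T|)%N by apply/card_gt0P; exists (tree_root tr).
exists (f #|T|); split.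
  split=> [j|n nn]; first exact: f_alt.
  rewrite -{1}(prednK Tgt0) f_nest //; apply: eq_step => z nz.
  have mz : (m z < #|T|)%N by rewrite -(m_arc _ _ nz) leq_subr.
  by apply: stable; [rewrite -ltnS prednK | exact: ltnW].
move=> b [b_alt b_nest]; apply/funext => z.
have [k] := ubnP (m z); elim: k z => // k IH z mk.
have [nz|nz] := boolP (nest z); last first.
  by rewrite -[z]/(sval (exist (fun z => ~~ nest z) z nz : alt)) f_alt b_alt.
rewrite b_nest // -(prednK Tgt0) f_nest //; apply: eq_step => y zy.
have my : (m y < #|T|)%N by rewrite -(m_arc _ _ zy) leq_subr.
rewrite -IH; last by rewrite -(m_arc _ _ zy).
by apply: stable; [rewrite -ltnS prednK | exact: ltnW].
Qed.

End Tree.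

Definition is_gumbel (R : realType) (mu : probability R R) : Prop :=
  forall x : R, mu `]-oo, x]%classic = (expR (- expR (- x)))%:E.

Definition is_positive_stable (R : realType) (l : R) (mu : probability R R)
    : Prop :=
  mu `[0, +oo[%classic = 1%E /\
  forall t : R, 0 <= t ->
    (\int[mu]_x (expR (- (t * x)))%:E = (expR (- (t `^ l)))%:E)%E.

(* Mutual independence of the random variables X i with i in D. *)
Definition mutually_independent (R : realType) (d : measure_display)
    (Omega : measurableType d) (P : probability Omega R)
    (I : finType) (D : {set I}) (X : I -> {RV P >-> R}) : Prop :=
  forall S : {set I}, (S \subset D)%SET ->
  forall B : I -> set R, (forall i, measurable (B i)) ->
    P [set w | forall i, i \in S -> B i (X i w)] =
    (\prod_(i in S) P (X i @^-1` B i))%E.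

(* The product sigma-algebra on R^I, generated by the coordinate maps. *)
Definition product_measurable (R : realType) (I : Type) : set (set (I -> R)) :=
  <<s [set C | exists i, exists2 B : set R,
                 measurable B & C = [set x : I -> R | B (x i)]] >>.

Definition same_joint_law (R : realType) (I : Type)
    (d : measure_display) (Omega : measurableType d) (P : probability Omega R)
    (X : I -> Omega -> R)
    (d' : measure_display) (Omega' : measurableType d')
    (P' : probability Omega' R) (Y : I -> Omega' -> R) : Prop :=
  forall C : set (I -> R), product_measurable C ->
    P [set w | C (fun i => X i w)] = P' [set w | C (fun i => Y i w)].

Section NestedLogit.
Context (R : realType) (T : finType) (tr : arborescence T) (lam : T -> R).
Context (d : measure_display) (Omega : measurableType d).
Context (P : probability Omega R).

(* For each A there is exactly one such a: see nl_values_exists_unique. *)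
Definition nested_logit (eps : alt tr -> {RV P >-> R}) : Prop :=
  forall (A : alt tr -> R) (a : T -> R), nl_values lam A a ->
    P [set w | forall j, eps j w <= A j] =
    (expR (- expR (- a (tree_root tr))))%:E.

(* Z is indexed by all nodes, but only its values at the nests other than the
   root are constrained or used. *)
Definition inner_nest (n : T) : bool := nest tr n && (n != tree_root tr).

Definition factors (U : alt tr -> {RV P >-> R}) (Z : T -> {RV P >-> R})
    (i : alt tr + T) : {RV P >-> R} :=
  match i with inl j => U j | inr n => Z n end.

Definition logit_factors (U : alt tr -> {RV P >-> R}) (Z : T -> {RV P >-> R})
    : Prop :=
  [/\ forall j, is_gumbel (distribution P (U j)),
      forall n, inner_nest n ->
        is_positive_stable (lam n) (distribution P (Z n))
    & mutually_independent
        [set i : alt tr + T | if i is inr n then inner_nest n else true]%SET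
        (factors U Z)].

Definition logit_representation (U : alt tr -> {RV P >-> R})
    (Z : T -> {RV P >-> R}) (j : alt tr) (w : Omega) : R :=
  \sum_(n <- tpath tr (parent tr (sval j))) Lambda tr lam n * ln (Z n w)
  + Lambda tr lam (parent tr (sval j)) * U j w.

End NestedLogit.

(* Main.v *)
From HB Require Import structures.
Require Import Defs.
From mathcomp Require Import all_boot all_order all_algebra.
From mathcomp Require Import all_classical all_reals all_analysis.
From mathcomp Require Import measurable_realfun.
From mathcomp Require Import ring.

Set Implicit Arguments.
Unset Strict Implicit.
Unset Printing Implicit Defensive.

Import Order.TTheory GRing.Theory Num.Theory.
Import numFieldNormedType.Exports.

Local Open Scope classical_set_scope.
Local Open Scope ring_scope.

(** Every node other than the root carries one random factor: the Gumbel
    variable of an alternative, or the positive stable variable of a nest.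
    The idea is to compute the joint distribution function of the represented
    vector by integrating these factors out one node at a time, deepest nodes
    first.

    Write L_n for the sum of Lambda_m log Z_m over the path from the root to n,
    and G for the Gumbel distribution function.  The event that the j-th
    component is at most A_j only involves L_p and U_j, with p the parent of j,
    and integrating over U_j replaces its indicator by
    G((a_j - L_p) / Lambda_p).  Once all the children z of a nest n have been
    integrated out, their factors G((a_z - L_n) / Lambda_n) multiply to
    G((a_n - L_n) / Lambda_n), because the exponents add up and a_n is the
    corresponding log-sum ([prod_gumbel_children]).  As
    L_n = L_p + Lambda_n log Z_n, this is exp(- t Z_n) with
    t = exp((L_p - a_n) / Lambda_n), so the Laplace transform of Z_n turns it
    into exp(- t^lambda_n), and since Lambda_n = lambda_n Lambda_p this is
    G((a_n - L_p) / Lambda_p) ([integral_nest_kernel]): an integrated nest looks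
    exactly like an integrated alternative.  The recursion therefore goes on up
    to the root, where it leaves G(a_0), which is the nested logit distribution
    function.

    [partial_cdf] is the integrand at an intermediate stage, indexed by the set
    S of nodes that remain.  Removing a deepest node of S preserves its
    expectation ([integral_partial_cdfD1]); this is Fubini's theorem for one
    factor that is independent of all the others ([integral_out]).  Finally, two
    random vectors with the same distribution function have the same law
    ([same_joint_law_cdf]), and independent factors with the prescribed laws
    exist on a product space ([independent_family_exists]). *)

(** * Integrating out one of several independent variables *)

Section Independence.
Context (R : realType) (d : measure_display) (Omega : measurableType d).
Context (P : probability Omega R) (I : finType).
Implicit Types (X : I -> {RV P >-> R}) (D : {set I}) (i : I).

Lemma measurable_box (X : I -> Omega -> R) D (B : I -> set R) :
  (forall k, measurable_fun setT (X k)) -> (forall k, measurable (B k)) ->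
  measurable [set w | forall k, k \in D -> B k (X k w)].
Proof.
move=> mX mB.
rewrite (_ : mkset _ = \bigcap_(k in [set k | k \in D]) (X k @^-1` B k)).
  apply: fin_bigcap_measurable => [|k _]; first exact: finite_finset.
  by rewrite -[_ @^-1` _]setTI; exact: mX.
by apply/seteqP; split => w.
Qed.

(** Generates the sigma-algebra of the variables of [D] other than [X i]. *)
Definition other_events X D i : set (set Omega) :=
  [set C | exists2 k, k \in (D :\ i)%SET &
           exists2 B : set R, measurable B & C = X k @^-1` B].

(** Mutual independence is a product rule for boxes only.  Boxes are stable
    under intersection, so two finite measures that agree on them agree on the whole
    sigma-algebra: here, [P] restricted to [X i @^-1` B], and [P] scaled by the
    probability of that event. *)
Lemma independent_other_events X D i (B : set R) (C : set Omega) :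
  mutually_independent D X -> i \in D -> measurable B ->
  <<s other_events X D i >> C ->
  P ((X i @^-1` B) `&` C) = (P (X i @^-1` B) * P C)%E.
Proof.
move=> indep iD mB sC.
pose G : set (set Omega) := [set E | exists B : I -> set R,
  (forall k, measurable (B k)) /\
  E = [set w | forall k, k \in (D :\ i)%SET -> B k (X k w)]].
have mXB : measurable (X i @^-1` B).
  by rewrite -[_ @^-1` _]setTI; exact: measurable_funPT.
have GT : G setT.
  by exists (fun=> setT); split => //; apply/seteqP; split.
have sGC : <<s G >> C.
  apply: sub_smallest2r sC => [|E [k kD [A mA ->]]].
    exact: smallest_sigma_algebra.
  exists (fun l => if l == k then A else setT); split=> [l|].
    by case: ifP.
  apply/seteqP; split => w /= => [Aw l _|]; first by case: eqP => // ->.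
  by move=> /(_ k kD); rewrite eqxx.
have pB : 0 <= fine (P (X i @^-1` B)) by exact: fine_ge0.
suff : mrestr P mXB C = mscale (NngNum pB) P C.
  by rewrite /mrestr /mscale /= fineK ?fin_num_measure// setIC.
apply: (@g_sigma_algebra_measure_unique _ R Omega G _ (fun=> setT)) => //.
- by move=> E [A [mA ->]]; exact: measurable_box.
- exact: bigcup_const.
- move=> E F [A [mA ->]] [A' [mA' ->]].
  exists (fun k => A k `&` A' k); split=> [k|]; first exact: measurableI.
  apply/seteqP; split => w /=; first by move=> [h h'] k kD; split; auto.
  by move=> h; split => k /h [].
- move=> _ [A [mA ->]].
  set E := mkset _.
  change (P (E `&` X i @^-1` B) = ((fine (P (X i @^-1` B)))%:E * P E)%E).
  rewrite fineK ?fin_num_measure// {}/E.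
  pose A' k := if k == i then B else A k.
  have mA' k : measurable (A' k) by rewrite /A'; case: ifP.
  rewrite [X in P X](_ : _ = [set w | forall k, k \in D -> A' k (X k w)]).
    rewrite !indep ?subD1set// (big_setD1 i)//= {1}/A' eqxx; congr (_ * _)%E.
    by apply: eq_bigr => k /setD1P[/negbTE ki _]; rewrite /A' ki.
  apply/seteqP; split => w /=.
    move=> [h Bw] k kD; rewrite /A'; have [->//|ki] := eqVneq k i.
    by apply: h; rewrite !inE ki.
  move=> h; split=> [k /setD1P[/negbTE ki kD]|].
    by have := h k kD; rewrite /A' ki.
  by have := h i iD; rewrite /A' eqxx.
- move=> _; change (mrestr P mXB setT < +oo)%E.
  by rewrite /mrestr ltey_eq fin_num_measure//; exact: measurableI.
Qed.

Lemma measurable_other_events X D i C :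
  <<s other_events X D i >> C -> measurable C.
Proof.
apply: smallest_sub; first exact: sigma_algebra_measurable.
move=> E [k kD [A mA ->]].
by rewrite -[_ @^-1` _]setTI; exact: measurable_funPT.
Qed.

(** The pair of [X i] and of the sample point itself, the latter seen through the
    sigma-algebra of the other variables, has a product law, so Tonelli's theorem
    applies.  Keeping the sample point, rather than the vector of the other
    variables, lets [f] involve any functions measurable in those variables. *)
Lemma integral_independent X D i
    (f : R * g_sigma_algebraType (other_events X D i) -> \bar R) :
  mutually_independent D X -> i \in D ->
  measurable_fun setT f -> (forall z, 0 <= f z)%E ->
  (\int[P]_w f (X i w, w) = \int[P]_w \int[distribution P (X i)]_x f (x, w))%E.
Proof.
move=> indep iD mf f0.
pose F := g_sigma_algebraType (other_events X D i).
have mid : measurable_fun setT (id : Omega -> F).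
  by move=> _ B mB; rewrite setTI; exact: measurable_other_events mB.
have mpair : measurable_fun setT (fun w : Omega => (X i w, w : F)).
  exact: measurable_fun_pair.
pose id' : {mfun Omega >-> F} :=
  HB.pack (id : Omega -> F) (isMeasurableFun.Build _ _ _ _ _ mid).
pose pair' : {mfun Omega >-> (R * F)%type} :=
  HB.pack (fun w : Omega => (X i w, w : F))
    (isMeasurableFun.Build _ _ _ _ _ mpair).
transitivity (\int[distribution P pair']_z f z)%E.
  by rewrite ge0_integral_distribution.
transitivity (\int[distribution P (X i) \x distribution P id']_z f z)%E.
  apply: eq_measure_integral => A mA _; apply/esym.
  apply: product_measure_unique => // B C mB mC.
  exact: (independent_other_events indep).
rewrite fubini_tonelli2// ge0_integral_distribution//.
- exact: measurable_fun_fubini_tonelli_G.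
- by move=> y; exact: integral_ge0.
Qed.

Lemma measurable_other X D i k : k \in (D :\ i)%SET ->
  measurable_fun setT (X k : g_sigma_algebraType (other_events X D i) -> R).
Proof.
move=> kD _ B mB; rewrite setTI; apply: sub_sigma_algebra.
by exists k => //; exists B.
Qed.

(** The form in which independence is used: [V] and [L] depend on the other
    variables only, and [g] is the conditional expectation of [K (X i, L)] as a
    function of [L]. *)
Lemma integral_out X D i
    (V L : g_sigma_algebraType (other_events X D i) -> R)
    (K : R * R -> R) (g : R -> R) :
  mutually_independent D X -> i \in D ->
  measurable_fun setT V -> measurable_fun setT L -> measurable_fun setT K ->
  (forall w, 0 <= V w) -> (forall z, 0 <= K z) ->
  (forall l, \int[distribution P (X i)]_x (K (x, l))%:E = (g l)%:E)%E ->
  (\int[P]_w (V w * K (X i w, L w))%:E = \int[P]_w (V w * g (L w))%:E)%E.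
Proof.
move=> indep iD mV mL mK V0 K0 Kg.
have := @integral_independent X D i
  (fun z => (V z.2 * K (z.1, L z.2))%:E) indep iD.
rewrite /= => ->; last 2 first.
- apply/measurable_EFinP; apply: measurable_funM.
    exact: measurableT_comp.
  apply: (measurableT_comp mK); apply: measurable_fun_pair => //.
  exact: measurableT_comp.
- by move=> z; rewrite lee_fin mulr_ge0.
apply: eq_integral => w _.
under eq_integral do rewrite EFinM.
rewrite ge0_integralZl_EFin ?Kg//.
- by move=> x _; rewrite lee_fin.
- apply/measurable_EFinP; apply: (measurableT_comp mK).
  exact: measurable_fun_pair.
Qed.

End Independence.

(** * Joint laws and distribution functions *)

Section JointLaw.
Context (R : realType) (I : finType).

Definition product_cylinders : set (set (I -> R)) :=
  [set C | exists i, exists2 B : set R,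
           measurable B & C = [set x : I -> R | B (x i)]].

Definition orthant (A : I -> R) : set (I -> R) :=
  [set x | forall i, x i <= A i].

Definition orthants : set (set (I -> R)) := [set C | exists A, C = orthant A].

(** The whole space need not be an orthant: sigma-finiteness of the generating family
    comes from this cover. *)
Lemma orthants_cover : \bigcup_n orthant (fun=> n%:R) = setT.
Proof.
apply/seteqP; split => // x _.
exists (Num.bound (\sum_i `|x i|)) => // i.
apply: le_trans (ler_norm _) _.
have : \sum_i `|x i| < (Num.bound (\sum_i `|x i|))%:R.
  by apply: archi_boundP; apply: sumr_ge0.
by move=> /ltW; apply: le_trans; rewrite (bigD1 i)//= lerDl sumr_ge0.
Qed.

Lemma product_measurable_orthants :
  product_measurable (R := R) (I := I) `<=` <<s orthants >>.
Proof.
apply: smallest_sub; first exact: smallest_sigma_algebra.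
move=> C [i [B mB ->]].
pose F := g_sigma_algebraType orthants.
suff : measurable_fun setT (fun x : F => x i).
  by move=> /(_ measurableT _ mB); rewrite setTI.
apply: (measurability _ (RGenOInfty.measurableE R)) => _ [_ [a ->] <-].
rewrite setTI -setCitvl preimage_setC; apply: measurableC.
(* A half-space bounds one coordinate only; the others get an arbitrary bound. *)
rewrite [X in measurable X](_ : _ =
    \bigcup_n orthant (fun j => if j == i then a else n%:R)).
  apply: bigcupT_measurable => n; apply: sub_sigma_algebra.
  by exists (fun j => if j == i then a else n%:R).
apply/seteqP; split => x /=; rewrite in_itv/=.
  move=> xa; have : [set: I -> R] x by [].
  rewrite -orthants_cover => -[n _ xn]; exists n => // j.
  by case: eqP => [->|_]; [exact: xa | exact: xn].
by move=> [n _ /(_ i)]; rewrite eqxx.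
Qed.

Lemma orthant_measurable A : product_measurable (orthant A).
Proof.
rewrite (_ : orthant A =
    \bigcap_(i in [set: I]) [set x : I -> R | `]-oo, A i]%classic (x i)]).
  apply: (@fin_bigcap_measurable _ (g_sigma_algebraType product_cylinders)).
    exact: finite_finset.
  move=> i _; apply: sub_sigma_algebra.
  by exists i, `]-oo, A i]%classic.
apply/seteqP; split => x /= h i; first by move=> _; rewrite /= in_itv/=.
by have := h i Logic.I; rewrite /= in_itv/=.
Qed.

Lemma measurable_vector d (Omega : measurableType d) (X : I -> Omega -> R) :
  (forall i, measurable_fun setT (X i)) ->
  measurable_fun setT
    (fun w => (fun i => X i w) : g_sigma_algebraType product_cylinders).
Proof.
move=> mX.
apply: (@measurability _ _ _ (g_sigma_algebraType product_cylinders) _ _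
  product_cylinders) => // _ [_ [i [B mB ->]] <-].
exact: mX.
Qed.

(** Orthants form a pi-system generating the product sigma-algebra, so the laws
    of two random vectors agree as soon as their distribution functions do. *)
Lemma same_joint_law_cdf d (Omega : measurableType d) (P : probability Omega R)
    d' (Omega' : measurableType d') (P' : probability Omega' R)
    (X : I -> Omega -> R) (Y : I -> Omega' -> R) :
  (forall i, measurable_fun setT (X i)) ->
  (forall i, measurable_fun setT (Y i)) ->
  (forall A : I -> R, P [set w | forall i, X i w <= A i] =
                      P' [set w | forall i, Y i w <= A i]) ->
  same_joint_law P X P' Y.
Proof.
move=> mX mY XY C /product_measurable_orthants mC.
pose F := g_sigma_algebraType product_cylinders.
pose X' : {mfun Omega >-> F} :=
  HB.pack (fun w => (fun i => X i w) : F)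
    (isMeasurableFun.Build _ _ _ _ _ (measurable_vector mX)).
pose Y' : {mfun Omega' >-> F} :=
  HB.pack (fun w => (fun i => Y i w) : F)
    (isMeasurableFun.Build _ _ _ _ _ (measurable_vector mY)).
change (distribution P X' C = distribution P' Y' C).
apply: (@g_sigma_algebra_measure_unique _ R F orthants _
  (fun n => orthant (fun=> n%:R))) => //.
- by move=> _ [A ->]; exact: orthant_measurable.
- by move=> n; exists (fun=> n%:R).
- exact: orthants_cover.
- move=> _ _ [A ->] [B ->]; exists (fun i => Num.min (A i) (B i)).
  apply/seteqP; split => x /=.
    by move=> [xA xB] i; rewrite le_min xA xB.
  by move=> h; split => i; have := h i; rewrite le_min => /andP[].
- by move=> _ [A ->]; exact: XY.
- by move=> n; rewrite ltey_eq fin_num_measure//; exact: orthant_measurable.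
Qed.

End JointLaw.

(** * Gumbel laws and independent families *)

Section Existence.
Context (R : realType).

Definition gumbel_cdf (x : R) : R := expR (- expR (- x)).

Lemma gumbel_cdf_nondecreasing : {homo gumbel_cdf : x y / x <= y}.
Proof. by move=> x y xy; rewrite ler_expR lerN2 ler_expR lerN2. Qed.

Lemma gumbel_cdf_continuous : continuous gumbel_cdf.
Proof.
move=> x; apply: continuous_comp; last exact: continuous_expR.
apply: continuousN; apply: continuous_comp; last exact: continuous_expR.
exact: opp_continuous.
Qed.

(** As [1 + y <= expR y] at [y = - x], the Gumbel distribution function is at
    most [expR x]. *)
Lemma gumbel_cdf_cvgNy : gumbel_cdf @ -oo --> (0 : R).
Proof.
have expR0 : expR x @[x --> -oo] --> (0 : R).
  by apply/cvgNy_compNP; exact: cvgr_expR.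
apply: (squeeze_cvgr _ (cvg_cst 0) expR0); apply: nearW => x.
rewrite expR_ge0 ler_expR -lerN2 opprK; apply: le_trans (expR_ge1Dx _).
by rewrite lerDr.
Qed.

Lemma gumbel_cdf_cvgy : gumbel_cdf @ +oo --> (1 : R).
Proof.
rewrite -(expR0 R) -oppr0; apply: continuous_cvg.
  exact: continuous_expR.
by apply: cvgN; exact: cvgr_expR.
Qed.

(** The Lebesgue-Stieltjes measure of the Gumbel distribution function. *)
Lemma gumbel_exists : exists mu : probability R R, is_gumbel mu.
Proof.
pose cumulative_gumbel : cumulativeBounded (0 : R) 1 :=
  HB.pack gumbel_cdf
    (isCumulative.Build _ _ _ gumbel_cdf gumbel_cdf_nondecreasing
      (right_continuousW gumbel_cdf_continuous))
    (isCumulativeBounded.Build _ _ _ gumbel_cdf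
      gumbel_cdf_cvgNy gumbel_cdf_cvgy).
eexists => x; exact: (cdf_lebesgue_stieltjes_id cumulative_gumbel x).
Qed.

(** By induction on an enumeration of the indices: each new variable is the first
    projection of a binary product of probability spaces, and the previous ones
    are composed with the second projection. *)
Lemma independent_family_exists (I : finType) (nu : I -> probability R R) :
  exists (d : measure_display) (Omega : measurableType d)
    (P : probability Omega R) (X : I -> {RV P >-> R}),
    (forall i (B : set R), measurable B -> distribution P (X i) B = nu i B) /\
    mutually_independent [set: I]%SET X.
Proof.
(* Along the enumeration, the laws and independence are only known for the
   indices already met. *)
suff : exists d (Omega : measurableType d)
    (P : probability Omega R) (X : I -> {RV P >-> R}),
    (forall i, i \in enum I ->
       forall B : set R, measurable B -> P (X i @^-1` B) = nu i B) /\
    mutually_independent [set i in enum I]%SET X.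
  move=> [d [W [P [X [XE indep]]]]]; exists d, W, P, X.
  split=> [i B mB|S _].
    by rewrite -XE ?mem_enum.
  by apply: indep; apply/fintype.subsetP => i _; rewrite inE mem_enum.
elim: (enum I) (enum_uniq I) => [_|i s IH /= /andP [ni us]].
  exists _, unit, (dirac tt), (fun=> cst 0); split => // S S0 B mB.
  have {S0} -> : S = finset.set0.
    apply/finset.setP => i; rewrite !inE; apply/negP => iS.
    by have := fintype.subsetP S0 _ iS; rewrite !inE.
  rewrite big_set0 -(@probability_setT _ unit R (dirac tt)); congr (_ _).
  by apply/seteqP; split => // w _ i; rewrite inE.
have [d [W [P [X [XE indep]]]]] := IH us.
have mXk k (B : set R) : measurable B -> measurable (X k @^-1` B).
  by move=> mB; rewrite -[_ @^-1` _]setTI; exact: measurable_funPT.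
have mX k : measurable_fun setT
    (fun z : R * W => if k == i then z.1 else X k z.2).
  case: (k == i); first exact: measurable_fst.
  by apply: measurableT_comp; [exact: measurable_funPT|exact: measurable_snd].
pose P' : probability (R * W)%type R := (nu i \x P)%E.
pose X' k : {RV P' >-> R} :=
  HB.pack (fun z : R * W => if k == i then z.1 else X k z.2)
    (isMeasurableFun.Build _ _ _ _ _ (mX k)).
have P'E (A : set R) (C : set W) :
    measurable A -> measurable C -> P' (A `*` C) = (nu i A * P C)%E.
  by move=> mA mC; exact: product_measure1E.
have X'i B : measurable B -> P' (X' i @^-1` B) = nu i B.
  move=> mB; rewrite (_ : _ @^-1` _ = B `*` setT).
    by rewrite P'E// probability_setT mule1.
  by apply/seteqP; split => z /=; rewrite eqxx// => -[].
have X'k k B : k != i -> measurable B -> P' (X' k @^-1` B) = P (X k @^-1` B).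
  move=> /negbTE ki mB; rewrite (_ : X' k @^-1` _ = setT `*` (X k @^-1` B)).
    by rewrite P'E ?probability_setT ?mul1e//; exact: mXk.
  by apply/seteqP; split => z /=; rewrite ki// => -[].
exists _, (R * W)%type, P', X'; split=> [k|S SD B mB].
  rewrite inE; have [-> _ B mB|ki /= ks B mB] := eqVneq k i; first exact: X'i.
  by rewrite X'k// XE.
(* When i is outside S the constraint on the new coordinate is void. *)
pose Bi := if i \in S then B i else setT.
have mBi : measurable Bi by rewrite /Bi; case: ifP.
rewrite [X in P' X](_ : _ =
    Bi `*` [set w | forall k, k \in (S :\ i)%SET -> B k (X k w)]).
  rewrite P'E ?indep//; [| |exact: measurable_box]; last first.
    apply/fintype.subsetP => k /setD1P[/negbTE ki /(fintype.subsetP SD)].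
    by rewrite !inE ki.
  rewrite (eq_bigr (fun k => P' (X' k @^-1` B k))); last first.
    by move=> k /setD1P[ki _]; rewrite X'k.
  rewrite /Bi; case: ifPn => iS; first by rewrite [RHS](big_setD1 i)//= X'i.
  rewrite probability_setT mul1e; apply: eq_bigl => k; rewrite !inE.
  by have [->|] := eqVneq k i; first by rewrite (negbTE iS).
apply/seteqP; split => z /=.
  move=> h; split=> [|k /setD1P[/negbTE ki kS]].
    by rewrite /Bi; case: ifPn => // iS; have := h i iS; rewrite eqxx.
  by have := h k kS; rewrite ki.
move=> [hi h] k kS; have [ki|ki] := eqVneq k i; last first.
  by apply: h; rewrite !inE ki.
by move: hi; rewrite /Bi -ki kS.
Qed.
End Existence.

(** * Integrals against Gumbel and positive stable laws *)

Section ExplicitIntegrals.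
Context (R : realType).

Lemma integral_gumbel_below (mu : probability R R) (s l A : R) :
  is_gumbel mu -> 0 < s ->
  (\int[mu]_x (if l + s * x <= A then 1 else 0 : R)%:E =
   (gumbel_cdf ((A - l) / s))%:E)%E.
Proof.
move=> mu_gumbel s0; rewrite -mu_gumbel.
transitivity (\int[mu]_x (\1_(`]-oo, (A - l) / s]%classic) x)%:E)%E; last first.
  by rewrite integral_indic ?setIT.
apply: eq_integral => x _; rewrite indicE; congr EFin.
rewrite mem_setE in_itv/= ler_pdivlMr// lerBrDl mulrC.
by case: ifP.
Qed.

(** Mass [m] at the origin gives Laplace transform at least [m] everywhere,
    whereas [expR (- (t `^ l))] tends to zero as [t] grows. *)
Lemma positive_stable_gt0 (l : R) (mu : probability R R) :
  0 < l -> is_positive_stable l mu -> mu `]-oo, 0]%classic = 0%E.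
Proof.
move=> l0 [mu_pos lap].
have muneg : mu `]-oo, 0[%classic = 0%E.
  rewrite -setCitvr probability_setC// mu_pos.
  by rewrite subee.
have mu0 : mu [set 0] = 0%E.
  pose m := fine (mu [set 0]).
  have mE : mu [set 0] = m%:E by rewrite fineK// fin_num_measure.
  (* The transform is taken at the l-th root of s, where it is exp(- s). *)
  have m_le s : 0 <= s -> m <= expR (- s).
    move=> s0; have t0 : 0 <= s `^ l^-1 by exact: powR_ge0.
    rewrite -lee_fin -mE.
    have -> : expR (- s) = expR (- ((s `^ l^-1) `^ l)).
      by rewrite -powRrM mulVf ?gt_eqF// powRr1.
    rewrite -lap//.
    have -> : mu [set 0] =
        (\int[mu]_(x in [set 0%R]) (expR (- (s `^ l^-1 * x)))%:E)%E.
      rewrite (eq_integral (fun=> 1%E)) ?integral_cst ?mul1e//.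
      by move=> x; rewrite inE/= => ->; rewrite mulr0 oppr0 expR0.
    apply: ge0_subset_integral => //.
    apply/measurable_EFinP; apply: measurableT_comp => //.
    by apply: measurable_funN; apply: measurable_funM.
  rewrite mE; congr EFin; apply/eqP; rewrite eq_le.
  apply/andP; split; last first.
    exact: fine_ge0.
  rewrite leNgt; apply/negP => m0.
  have m1 : m <= 1 by have := m_le 0 (lexx _); rewrite oppr0 expR0.
  (* At s = 1 - ln m the bound reads m <= m / e. *)
  have /m_le : 0 <= 1 - ln m by rewrite subr_ge0 (le_trans (ln_le0 m1)).
  rewrite opprB addrC expRD lnK// ler_pMl// leNgt.
  by rewrite expR_lt1 ltrN10.
have -> : `]-oo, 0]%classic = `]-oo, 0[%classic `|` [set 0 : R].
  by rewrite setUitv1.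
apply/eqP; rewrite -measure_le0.
apply: le_trans (measureU2 _ _ _) _ => //.
by rewrite [X in (X + _)%E]muneg [X in (_ + X)%E]mu0 adde0.
Qed.

(** As [ln] is zero on nonpositive reals, [expR (ln x)] is [x] only for positive
    [x]; the law does not charge the other values. *)
Lemma integral_positive_stable (l t : R) (mu : probability R R) :
  0 < l -> is_positive_stable l mu -> 0 <= t ->
  (\int[mu]_x (expR (- (t * expR (ln x))))%:E = (expR (- (t `^ l)))%:E)%E.
Proof.
move=> l0 stable t0; rewrite -(stable.2 t t0).
apply: ge0_ae_eq_integral => //.
- apply/measurable_EFinP; apply: measurableT_comp => //.
  apply: measurable_funN; apply: measurable_funM => //.
  exact: measurableT_comp.
- apply/measurable_EFinP; apply: measurableT_comp => //.
  by apply: measurable_funN; apply: measurable_funM.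
exists `]-oo, 0]%classic; split => //.
  exact: positive_stable_gt0 stable.
move=> x /= h; rewrite in_itv/= leNgt; apply/negP => x0.
by apply: h => _; rewrite lnK.
Qed.

End ExplicitIntegrals.

(** * Paths and scales in an arborescence *)

Section TreeStructure.
Context (T : finType) (tr : arborescence T).
Local Notation root := (tree_root tr).
Local Notation arc := (tree_arc tr).

Definition depth (z : T) : nat := size (tpath tr z).

Lemma tpath_root : tpath tr root = [::].
Proof. by apply: tpath_unique; rewrite /is_walk /= eqxx. Qed.

Lemma depth_arc y z : arc y z -> depth z = (depth y).+1.
Proof. by move=> yz; rewrite /depth (tpath_arc yz) size_rcons. Qed.

Lemma arc_neq_root y z : arc y z -> z != root.
Proof.
by move=> /depth_arc; rewrite /depth; case: eqP => // ->; rewrite tpath_root.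
Qed.

Lemma arc_parent z : z != root -> arc (parent tr z) z.
Proof.
move=> zr; have /andP[] := tpath_walk tr z.
case/lastP: (tpath tr z) => [_ /eqP rz|p y].
  by rewrite -rz eqxx in zr.
rewrite rcons_path last_rcons => /andP[_ yz] /eqP yz'; rewrite yz' in yz.
by rewrite (parent_arc yz).
Qed.

Lemma parent_root : parent tr root = root.
Proof.
by rewrite /parent; case: pickP => // y /arc_neq_root; rewrite eqxx.
Qed.

Lemma parent_neq z : z != root -> parent tr z != z.
Proof.
move=> /arc_parent /depth_arc dz; apply/eqP => pz.
by move: dz; rewrite pz; exact: n_Sn.
Qed.

Lemma parent_eq_arc v z : v != root ->
  (z != v) && (parent tr z == v) = arc v z.
Proof.
move=> vr; apply/andP/idP => [[zv /eqP pz]|vz].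
  rewrite -pz; apply: arc_parent; apply: contra vr => /eqP zr.
  by rewrite -pz zr parent_root.
rewrite (parent_arc vz); split => //; rewrite eq_sym -{1}(parent_arc vz).
exact: parent_neq (arc_neq_root vz).
Qed.

Lemma arc_nest y z : arc y z -> nest tr y.
Proof. by move=> yz; apply/existsP; exists z. Qed.

Lemma parent_nest z : z != root -> nest tr (parent tr z).
Proof. by move=> /arc_parent /arc_nest. Qed.

(** Induction from the root to the leaves, although an arborescence is not an
    inductive type. *)
Lemma tree_ind (Q : T -> Prop) :
  Q root -> (forall y z, arc y z -> Q y -> Q z) -> forall z, Q z.
Proof.
move=> Qroot Qarc z; have [k] := ubnP (depth z); elim: k z => // k IH z zk.
have [->//|zr] := eqVneq z root; have pz := arc_parent zr.
by apply: (Qarc _ _ pz); apply: IH; rewrite (depth_arc pz) in zk.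
Qed.

(** Strictness of the depth makes the factor of a deepest node absent from the
    scales of all the other remaining nodes. *)
Lemma mem_tpath z m : m \in tpath tr z -> (depth m < depth z)%N || (m == z).
Proof.
elim/tree_ind: z => [|y z yz IH]; first by rewrite tpath_root.
rewrite (tpath_arc yz) mem_rcons inE => /predU1P[->|/IH].
  by rewrite eqxx orbT.
rewrite (depth_arc yz) ltnS; case/orP => [/ltnW ->//|/eqP ->].
by rewrite leqnn.
Qed.

Lemma tpath_inner_nest z m :
  nest tr z -> m \in tpath tr z -> inner_nest tr m.
Proof.
elim/tree_ind: z => [|y z yz IH] nz; first by rewrite tpath_root.
rewrite (tpath_arc yz) mem_rcons inE => /predU1P[->|/IH].
  by rewrite /inner_nest nz (arc_neq_root yz).
by apply; exact: arc_nest yz.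
Qed.

Lemma nest_root : (1 < #|T|)%N -> nest tr root.
Proof.
move=> T1; have /card_gt0P[z] : (0 < #|[set~ root]%SET|)%N.
  by rewrite cardsC1; case: #|T| T1 => [|[]].
rewrite !inE => zr; have /andP[] := tpath_walk tr z.
case: (tpath tr z) => [_ /= /eqP rz|y p /= /andP[ry _] _].
  by rewrite rz eqxx in zr.
exact: arc_nest ry.
Qed.

Section Scale.
Context (R : realType) (lam : T -> R).

Lemma Lambda_root : Lambda tr lam root = 1.
Proof. by rewrite /Lambda tpath_root big_nil. Qed.

Lemma Lambda_arc y z :
  arc y z -> Lambda tr lam z = Lambda tr lam y * lam z.
Proof. by move=> yz; rewrite /Lambda (tpath_arc yz) big_rcons/= mulrC. Qed.

Lemma Lambda_gt0 z : (forall n, nest tr n -> 0 < lam n) ->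
  nest tr z -> 0 < Lambda tr lam z.
Proof.
move=> lam0; elim/tree_ind: z => [_|y z yz IH nz]; first by rewrite Lambda_root.
by rewrite (Lambda_arc yz) mulr_gt0 ?lam0 ?IH ?(arc_nest yz).
Qed.

(** The stability of Gumbel variables under maxima: the product of the
    distribution functions with locations [a z] is the one located at their
    scaled log-sum, which is [a n]. *)
Lemma prod_gumbel_children (A : alt tr -> R) (a : T -> R) n l :
  nl_values lam A a -> nest tr n -> 0 < Lambda tr lam n ->
  \prod_(z | arc n z) gumbel_cdf ((a z - l) / Lambda tr lam n) =
  gumbel_cdf ((a n - l) / Lambda tr lam n).
Proof.
move=> [_ nl] nn Ln; rewrite nl//.
set La := Lambda tr lam n; set s := \sum_(z | _) _.
have s0 : 0 < s.
  have /existsP[y ny] := nn; rewrite /s (bigD1 y)//=.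
  by rewrite ltr_pwDl ?expR_gt0// sumr_ge0// => z _; exact: expR_ge0.
rewrite /gumbel_cdf -expR_sum sumrN; congr (expR (- _)).
transitivity (expR (l / La) * s).
  rewrite mulr_sumr; apply: eq_bigr => z _; rewrite -expRD; congr expR.
  by rewrite !mulrBl !mulNr opprB.
rewrite -{1}(lnK s0) -expRD; congr expR.
by field; rewrite gt_eqF.
Qed.

End Scale.
End TreeStructure.

(** * Integrating out the tree from the leaves to the root *)

Section PartialIntegration.
Context (R : realType) (T : finType) (tr : arborescence T).
Context (lam : T -> R) (A : alt tr -> R) (a : T -> R).
Local Notation root := (tree_root tr).
Local Notation arc := (tree_arc tr).
Local Notation La := (Lambda tr lam).

(** The contribution of the nests to the components below [n].  The factors are
    plain functions, as they are used both on the sample space and on the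
    same set with a smaller sigma-algebra. *)
Definition log_scale (W : Type) (Z : T -> W -> R) (n : T) (w : W) : R :=
  \sum_(m <- tpath tr n) La m * ln (Z m w).

Lemma log_scale_arc (W : Type) (Z : T -> W -> R) y z w : arc y z ->
  log_scale Z z w = log_scale Z y w + La z * ln (Z z w).
Proof. by move=> yz; rewrite /log_scale (tpath_arc yz) big_rcons/= addrC. Qed.

Lemma measurable_log_scale d (W : measurableType d) (Z : T -> W -> R) n :
  (forall m, m \in tpath tr n -> measurable_fun setT (Z m)) ->
  measurable_fun setT (log_scale Z n).
Proof.
move=> mZ; rewrite /log_scale.
under eq_fun do rewrite big_seq big_mkcond.
apply: measurable_sum => m.
case: (m \in tpath tr n) (mZ m) => [/(_ isT) mZm|_]; last exact: measurable_cst.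
by apply: measurable_funM => //; exact: measurableT_comp.
Qed.

(** What the node [z] contributes when exactly the nodes of [S] remain to be
    integrated: the indicator of the event for a remaining alternative, nothing
    for a remaining nest, and a Gumbel factor for a node integrated out.  Below
    the topmost nodes integrated out nothing is left, since the children of such
    a node have been absorbed in its own factor. *)
Definition node_factor (W : Type) (U : alt tr -> W -> R) (Z : T -> W -> R)
    (S : {set T}) (z : T) (w : W) : R :=
  let p := parent tr z in
  if z \in S then
    if insub z is Some j then
      if log_scale Z p w + La p * U j w <= A j then 1 else 0
    else 1
  else if p \in S then gumbel_cdf ((a z - log_scale Z p w) / La p)
  else 1.

Definition partial_cdf (W : Type) (U : alt tr -> W -> R) (Z : T -> W -> R)
    (S : {set T}) (w : W) : R := \prod_z node_factor U Z S z w.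

Lemma node_factor_ge0 (W : Type) (U : alt tr -> W -> R) (Z : T -> W -> R)
    (S : {set T}) z w :
  0 <= node_factor U Z S z w.
Proof.
rewrite /node_factor; case: ifP => _; last by case: ifP; rewrite ?expR_ge0.
by case: insub => // j; case: ifP.
Qed.

Lemma measurable_gumbel_cdf : measurable_fun setT (@gumbel_cdf R).
Proof. by apply: continuous_measurable_fun; exact: gumbel_cdf_continuous. Qed.

Lemma measurable_node_factor d (W : measurableType d)
    (U : alt tr -> W -> R) (Z : T -> W -> R)
    (S : {set T}) z :
  (parent tr z \in S -> measurable_fun setT (log_scale Z (parent tr z))) ->
  (z \in S -> parent tr z \in S) ->
  (forall j, sval j = z -> measurable_fun setT (U j)) ->
  measurable_fun setT (node_factor U Z S z).
Proof.
move=> mL closed mU; rewrite /node_factor.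
case: (z \in S) closed => [/(_ isT) pS|_].
  case: insubP => [j _ jz|_]; last exact: measurable_cst.
  apply: measurable_fun_ifT => //; apply: measurable_fun_ler => //.
  apply: measurable_funD; first exact: mL.
  by apply: measurable_funM => //; exact: mU.
case: (parent tr z \in S) mL => [/(_ isT) mL|_]; last exact: measurable_cst.
apply: (measurableT_comp measurable_gumbel_cdf).
by apply: measurable_funM => //; apply: measurable_funB => //; exact: mL.
Qed.

Hypotheses (card_T : (1 < #|T|)%N)
  (lam_itv : forall n, nest tr n -> 0 < lam n <= 1)
  (a_nl : nl_values lam A a).

Let lam_gt0 n : nest tr n -> 0 < lam n.
Proof. by move=> /lam_itv /andP[]. Qed.

Let La_gt0 n : nest tr n -> 0 < La n.
Proof. by move=> nn; apply: Lambda_gt0. Qed.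

Lemma node_factor_root (W : Type) (U : alt tr -> W -> R) (Z : T -> W -> R)
    (S : {set T}) w : root \in S -> node_factor U Z S root w = 1.
Proof.
by move=> rS; rewrite /node_factor rS insubN ?negbK ?(nest_root tr card_T).
Qed.

Lemma partial_cdf_root (W : Type) (U : alt tr -> W -> R) (Z : T -> W -> R) w :
  partial_cdf U Z [set root]%SET w = gumbel_cdf (a root).
Proof.
have nroot := nest_root tr card_T.
transitivity (gumbel_cdf ((a root - 0) / La root)); last first.
  by rewrite Lambda_root divr1 subr0.
rewrite -(prod_gumbel_children 0 a_nl)// ?La_gt0//.
rewrite /partial_cdf [RHS]big_mkcond; apply: eq_bigr => z _.
have [->|zr] := eqVneq z root.
  rewrite node_factor_root ?inE//; case: ifP => // /arc_neq_root.
  by rewrite eqxx.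
rewrite /node_factor !inE (negbTE zr).
have -> : (parent tr z == root) = arc root z.
  apply/eqP/idP => [<-|]; first exact: arc_parent.
  exact: parent_arc.
case: (boolP (arc root z)) => [rz|//].
by rewrite (parent_arc rz) /log_scale tpath_root big_nil.
Qed.

Lemma partial_cdf_setT (W : Type) (U : alt tr -> W -> R) (Z : T -> W -> R) w :
  partial_cdf U Z [set: T]%SET w =
  \1_[set w | forall j : alt tr,
    log_scale Z (parent tr (sval j)) w + La (parent tr (sval j)) * U j w <= A j]
  w.
Proof.
rewrite /partial_cdf indicE /node_factor.
under eq_bigr do rewrite inE.
set C := mkset _; have [h|h] := pselect (C w).
  rewrite mem_set// big1// => z _; case: insubP => // j _ jz.
  by rewrite -jz h.
rewrite memNset//; move/existsNP : h => [j hj].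
by rewrite (bigD1 (sval j))//= valK ifF ?mul0r//; apply/negP.
Qed.

Context (d : measure_display) (W : measurableType d) (P : probability W R).
Context (U : alt tr -> {RV P >-> R}) (Z : T -> {RV P >-> R}).
Hypothesis UZ : logit_factors lam U Z.

Let D : {set alt tr + T} :=
  [set i : alt tr + T | if i is inr n then inner_nest tr n else true]%SET.

(** The dependence of [partial_cdf] on the factor of the node to be removed: the
    first component stands for this factor, and the second one for the
    [log_scale] of the parent. *)
Definition leaf_kernel (j : alt tr) (x : R * R) : R :=
  if x.2 + La (parent tr (sval j)) * x.1 <= A j then 1 else 0.

Definition nest_kernel (v : T) (x : R * R) : R :=
  \prod_(z | arc v z) gumbel_cdf ((a z - (x.2 + La v * ln x.1)) / La v).

Lemma integral_leaf_kernel j l :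
  (\int[distribution P (U j)]_x (leaf_kernel j (x, l))%:E =
   (gumbel_cdf ((a (sval j) - l) / La (parent tr (sval j))))%:E)%E.
Proof.
have [gumbelU _ _] := UZ.
rewrite /leaf_kernel (integral_gumbel_below _ _ (gumbelU j)); last first.
  apply/La_gt0/parent_nest; apply: contra (svalP j) => /eqP ->.
  exact: nest_root.
by have [-> _] := a_nl.
Qed.

(** The children merge into one Gumbel factor, an exponential in [Z v] with
    parameter [t].  The Laplace transform raises [t] to the power [lam v], which
    replaces [Lambda v] in the exponent by the scale of the parent. *)
Lemma integral_nest_kernel v l : inner_nest tr v ->
  (\int[distribution P (Z v)]_x (nest_kernel v (x, l))%:E =
   (gumbel_cdf ((a v - l) / La (parent tr v)))%:E)%E.
Proof.
move=> iv; have /andP[nv vr] := iv; have pv := arc_parent vr.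
have Lv := La_gt0 nv; have Lp := La_gt0 (parent_nest vr).
have [_ stableZ _] := UZ.
pose t := expR ((l - a v) / La v).
transitivity (\int[distribution P (Z v)]_x (expR (- (t * expR (ln x))))%:E)%E.
  apply: eq_integral => x _; congr EFin.
  rewrite /nest_kernel /= (prod_gumbel_children _ a_nl)//.
  rewrite /gumbel_cdf /t -expRD; congr (expR (- expR _)).
  by field; rewrite gt_eqF.
rewrite (integral_positive_stable (lam_gt0 nv) (stableZ _ iv)) ?expR_ge0//.
congr (expR (- _))%:E; rewrite /t -expRM; congr expR.
rewrite (Lambda_arc lam pv); field.
by rewrite !gt_eqF// lam_gt0.
Qed.

Lemma measurable_leaf_kernel j : measurable_fun setT (leaf_kernel j).
Proof.
apply: measurable_fun_ifT => //; apply: measurable_fun_ler => //.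
by apply: measurable_funD => //; exact: measurable_funM.
Qed.

Lemma measurable_nest_kernel v : measurable_fun setT (nest_kernel v).
Proof.
rewrite /nest_kernel; under eq_fun do rewrite big_mkcond.
apply: measurable_prod => z _.
case: (arc v z); last exact: measurable_cst.
apply: (measurableT_comp measurable_gumbel_cdf).
apply: measurable_funM => //; apply: measurable_funB => //.
apply: measurable_funD => //; apply: measurable_funM => //.
exact: measurableT_comp.
Qed.

(** Only the factors of [v] and of its children involve the random variable
    attached to [v], as [v] is a deepest remaining node.  They form a kernel which
    the integration turns into the factor of [v] as a removed node. *)
Lemma integral_partial_cdfD1 (S : {set T}) v :
  root \in S -> (forall z, z \in S -> z != root -> parent tr z \in S) ->
  v \in S -> v != root -> (forall z, z \in S -> (depth tr z <= depth tr v)%N) ->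
  (\int[P]_w (partial_cdf U Z S w)%:E =
   \int[P]_w (partial_cdf U Z (S :\ v)%SET w)%:E)%E.
Proof.
move=> rS closed vS vr deepest.
pose p := parent tr v.
have pv : p != v := parent_neq vr.
have childS z : arc v z -> z \notin S.
  move=> vz; apply/negP => /deepest.
  by rewrite (depth_arc vz) ltnn.
pose X := factors U Z.
(* The index i of the variable attached to v, and the kernel K gathering v and
   its children. *)
have [i [K [iD iv mK K0 [KE Kg]]]] :
    exists (i : alt tr + T) (K : R * R -> R),
    [/\ i \in D,
        (forall j, inl j = i -> sval j = v) /\ (forall m, inr m = i -> m = v),
        measurable_fun setT K,
        (forall x, 0 <= K x) &
        (forall w, node_factor U Z S v w *
           \prod_(z | arc v z) node_factor U Z S z w =
           K (X i w, log_scale Z p w)) /\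
        (forall l, \int[distribution P (X i)]_x (K (x, l))%:E =
           (gumbel_cdf ((a v - l) / La p))%:E)%E].
  have [nv|av] := boolP (nest tr v).
    have inv : inner_nest tr v by rewrite /inner_nest nv.
    exists (inr v), (nest_kernel v); split.
    - by rewrite inE.
    - by split=> [//|m []].
    - exact: measurable_nest_kernel.
    - by move=> x; apply: prodr_ge0 => z _; exact: expR_ge0.
    split=> [w|l]; last exact: integral_nest_kernel.
    rewrite /node_factor vS insubN ?negbK// mul1r /nest_kernel /=.
    apply: eq_bigr => z vz; rewrite (negbTE (childS z vz)) (parent_arc vz) vS.
    by rewrite (log_scale_arc _ _ (arc_parent vr)).
  pose j : alt tr := exist _ v av.
  exists (inl j), (leaf_kernel j); split.
  - by rewrite inE.
  - by split=> [k [->]|//].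
  - exact: measurable_leaf_kernel.
  - by move=> x; rewrite /leaf_kernel; case: ifP.
  split=> [w|l]; last exact: (integral_leaf_kernel j).
  rewrite big1 => [|z vz]; last first.
    by have := arc_nest vz; rewrite (negbTE av).
  rewrite /node_factor vS mulr1 (_ : insub v = Some j) //.
  exact: (valK j).
pose rest w := \prod_(z | (z != v) && (parent tr z != v)) node_factor U Z S z w.
have partialE S' w : partial_cdf U Z S' w =
    (node_factor U Z S' v w * \prod_(z | arc v z) node_factor U Z S' z w) *
    \prod_(z | (z != v) && (parent tr z != v)) node_factor U Z S' z w.
  rewrite /partial_cdf (bigD1 v)//= (bigID (fun z => parent tr z == v))/= mulrA.
  by congr (_ * _ * _); apply: eq_bigl => z; exact: parent_eq_arc.
have ES w : partial_cdf U Z S w = rest w * K (X i w, log_scale Z p w).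
  by rewrite partialE KE mulrC.
have ESv w : partial_cdf U Z (S :\ v)%SET w =
    rest w * gumbel_cdf ((a v - log_scale Z p w) / La p).
  rewrite partialE mulrC; congr (_ * _).
    apply: eq_bigr => z /andP[zv pzv].
    by rewrite /node_factor !inE zv pzv.
  rewrite [X in _ * X]big1 ?mulr1 => [|z vz].
    rewrite /node_factor !inE eqxx/= -/p pv.
    by rewrite (closed _ vS vr).
  rewrite /node_factor !inE (negbTE (childS z vz)) andbF.
  by rewrite (parent_arc vz) eqxx.
under eq_integral do rewrite ES.
under [RHS]eq_integral do rewrite ESv.
have [_ _ indep] := UZ.
pose F := g_sigma_algebraType (other_events X D i).
(* v is on the path to a remaining node q only if q = v, so the scale of any
   other q does not involve the variable i. *)
have mL q : q \in S -> q != v -> nest tr q ->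
    measurable_fun [set: F] (log_scale Z q).
  move=> qS qv nq; apply: measurable_log_scale => m mq.
  have mi : inr m \in (D :\ i)%SET.
    rewrite !inE (tpath_inner_nest nq mq) andbT.
    apply/eqP => /iv.2 mv; move: mq qv; rewrite mv => /mem_tpath.
    by rewrite ltnNge (deepest _ qS) /= eq_sym => ->.
  exact: (measurable_other mi).
apply: (@integral_out _ _ _ P _ X D i rest (log_scale Z p) K
  (fun l => gumbel_cdf ((a v - l) / La p))) => //.
- rewrite /rest; under eq_fun do rewrite big_mkcond.
  apply: measurable_prod => z _.
  case: (boolP ((z != v) && _)) => [/andP[zv pzv]|_]; last exact: measurable_cst.
  have [zr|zr] := eqVneq z root.
    rewrite zr [X in measurable_fun _ X](_ : _ = cst 1); last first.
      by apply/funext => w; exact: node_factor_root.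
    exact: measurable_cst.
  apply: measurable_node_factor.
  + by move=> pS; apply: mL => //; exact: parent_nest.
  + by move=> zS; exact: closed.
  + move=> j jz; have ji : inl j \in (D :\ i)%SET.
      by rewrite !inE andbT; apply/eqP => /iv.1 jv; rewrite -jz jv eqxx in zv.
    exact: (measurable_other ji).
- by apply: mL => //; [exact: closed|exact: parent_nest].
- by move=> w; apply: prodr_ge0 => z _; exact: node_factor_ge0.
Qed.

Lemma integral_partial_cdf (S : {set T}) :
  root \in S -> (forall z, z \in S -> z != root -> parent tr z \in S) ->
  (\int[P]_w (partial_cdf U Z S w)%:E = (gumbel_cdf (a root))%:E)%E.
Proof.
have [k] := ubnP #|S|; elim: k S => // k IH S Sk rS closed.
have [S1|[v0 v0S]] := finset.set_0Vmem (S :\ root)%SET.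
  have -> : S = [set root]%SET by rewrite -(finset.setD1K rS) S1 finset.setU0.
  under eq_integral do rewrite partial_cdf_root.
  by rewrite integral_cst// [X in (_ * X)%E]probability_setT mule1.
case: (@arg_maxnP _ v0 (fun v => v \in (S :\ root)%SET) (depth tr) v0S).
move=> v /setD1P[vr vS] deepest.
have {}deepest z : z \in S -> (depth tr z <= depth tr v)%N.
  move=> zS; have [->|zr] := eqVneq z root.
    by rewrite /depth tpath_root.
  by apply: deepest; rewrite !inE zr.
rewrite (integral_partial_cdfD1 rS closed vS vr deepest); apply: IH.
- by move: Sk; rewrite (cardsD1 v) vS.
- by rewrite !inE eq_sym vr.
- move=> z /setD1P[zv zS] zr; rewrite !inE closed// andbT.
  apply/eqP => pz; have := deepest z zS.
  by rewrite (depth_arc (arc_parent zr)) pz ltnn.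
Qed.

Lemma measurable_logit_representation j :
  measurable_fun setT (logit_representation lam U Z j).
Proof.
apply: measurable_funD; last exact: measurable_funM.
by apply: (measurable_log_scale (Z := Z)) => m _.
Qed.

(** With all nodes remaining, [partial_cdf] is the indicator of the event; with
    the root only, it is constant. *)
Lemma logit_representation_cdf :
  P [set w | forall j, logit_representation lam U Z j w <= A j] =
  (expR (- expR (- a root)))%:E.
Proof.
rewrite -/(gumbel_cdf (a root)) -(@integral_partial_cdf [set: T]%SET).
- under eq_integral do rewrite partial_cdf_setT.
  rewrite integral_indic ?setIT//.
  rewrite (_ : mkset _ = [set w | forall j, j \in [set: alt tr]%SET ->
      `]-oo, A j]%classic (logit_representation lam U Z j w)]).
    apply: (@measurable_box _ _ _ _ (logit_representation lam U Z) _
      (fun j => `]-oo, A j]%classic)) => // j.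
    exact: measurable_logit_representation.
  by apply/seteqP; split => w /= h j; have := h j; rewrite inE in_itv/=; auto.
- by rewrite inE.
- by move=> z _ _; rewrite inE.
Qed.

End PartialIntegration.

(** * The representation *)

Theorem proposition2 (R : realType) (T : finType) (tr : arborescence T)
    (card_T : (1 < #|T|)%N)
    (lam : T -> R) (lam_itv : forall n, nest tr n -> 0 < lam n <= 1)
    (lam_root : lam (tree_root tr) = 1)
    (d : measure_display) (Omega : measurableType d) (P : probability Omega R)
    (eps : alt tr -> {RV P >-> R}) (eps_nl : nested_logit lam eps) :
  (forall (d' : measure_display) (Omega' : measurableType d')
      (P' : probability Omega' R)
      (U : alt tr -> {RV P' >-> R}) (Z : T -> {RV P' >-> R}),
      logit_factors lam U Z ->
      same_joint_law P eps P' (logit_representation lam U Z))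
  /\
  ((forall n, inner_nest tr n ->
      exists mu : probability R R, is_positive_stable (lam n) mu) ->
   exists (d' : measure_display) (Omega' : measurableType d')
      (P' : probability Omega' R)
      (U : alt tr -> {RV P' >-> R}) (Z : T -> {RV P' >-> R}),
      logit_factors lam U Z /\
      same_joint_law P eps P' (logit_representation lam U Z)).
Proof.
have represents d' (Omega' : measurableType d') (P' : probability Omega' R)
    (U : alt tr -> {RV P' >-> R}) (Z : T -> {RV P' >-> R}) :
    logit_factors lam U Z ->
    same_joint_law P eps P' (logit_representation lam U Z).
  move=> UZ; apply: same_joint_law_cdf => [//|j|A].
    exact: measurable_logit_representation.
  have [a [a_nl _]] := nl_values_exists_unique lam A.
  rewrite (eps_nl A a a_nl); apply/esym.
  exact: logit_representation_cdf.
split=> [//|stable].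
have [gumbel gumbelP] := gumbel_exists R.
(* Any law would do for Z n at the root and at the alternatives. *)
have law n : exists mu : probability R R,
    inner_nest tr n -> is_positive_stable (lam n) mu.
  have [/stable[mu mu_stable]|_] := boolP (inner_nest tr n); first by exists mu.
  by exists gumbel.
have [stable_law stable_lawP] := choice law.
have [d' [W [P' [X [XE indep]]]]] := independent_family_exists
  (fun i : alt tr + T =>
     match i with inl _ => gumbel | inr n => stable_law n end).
pose U j := X (inl j); pose Z n := X (inr n).
suff UZ : logit_factors lam U Z.
  by exists d', W, P', U, Z; split; [|exact: represents].
split=> [j x|n /stable_lawP[mass laplace]|S _ B mB].
- transitivity (gumbel `]-oo, x]%classic); last exact: gumbelP.
  exact: (XE (inl j)).
- split=> [|t t0]; first by rewrite -mass; exact: (XE (inr n)).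
  rewrite -laplace//; apply: eq_measure_integral => B mB _.
  exact: (XE (inr n)).
- have factorsE : factors U Z = X by apply/funext => -[].
  rewrite factorsE; apply: indep; last exact: mB.
  by apply/fintype.subsetP => i _; rewrite inE.
Qed.
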